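(* The derivative $\partial w$ of every proper Christoffel word $w$ over $\{a,b\}$ is a Christoffel word.
   Context: Alphabet $\mathcal A=\{a,b\}$. The right palindromic closure $u^{(+)}$ of a word $u$ is the shortest palindrome having $u$ as a prefix. The palindromization map $\psi:\mathcal A^*\to\mathcal A^*$ is defined by $\psi(\varepsilon)=\varepsilon$ and $\psi(ux)=(\psi(u)x)^{(+)}$ for $u\in\mathcal A^*$, $x\in\mathcal A$; it is injective. A Christoffel word is either a single letter $a$ or $b$, or a word of the form $a\psi(v)b$ with $v\in\mathcal A^*$; the latter are called proper Christoffel words. Every nonempty $v$ is uniquely written $v=x_0^{\alpha_0}x_1^{\alpha_1}\cdots x_n^{\alpha_n}$ with $x_i\in\mathcal A$, $\alpha_i\ge1$, $x_{i+1}\neq x_i$. The index of $\psi(v)$ (and of the Christoffel word $a\psi(v)b$) is $0$ if $v=\varepsilon$ and $\alpha_0$ otherwise. For $k\ge0$ let $\varphi_k$ be the morphism $a\mapsto a^{k+1}b$, $b\mapsto a^kb$ and $\hat\varphi_k$ the morphism $a\mapsto ab^k$, $b\mapsto ab^{k+1}$ (both injective). Derivative: for a proper Christoffel word $w=a\psi(v)b$ of index $k$: if $k=0$ (i.e. $w=ab$), $\partial w=a$; if $k>0$ and $v$ begins with $a$, then $w\in\{a^kb,a^{k+1}b\}^*$ and $\partial w=\varphi_k^{-1}(w)$ (the unique word $u$ with $\varphi_k(u)=w$); if $k>0$ and $v$ begins with $b$, then $w\in\{ab^k,ab^{k+1}\}^*$ and $\partial w=\hat\varphi_k^{-1}(w)$.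 *)

(* Defs.v *)
(* MathComp; classical choice (epsilon) is used for definite descriptions. *)
From HB Require Import structures.
From mathcomp Require Import all_boot.
From Stdlib Require Import ClassicalEpsilon.

Set Implicit Arguments.
Unset Strict Implicit.
Unset Printing Implicit Defensive.

Inductive letter := la | lb.

Definition bool_of_letter x := if x is la then false else true.
Definition letter_of_bool c := if c then lb else la.
Lemma bool_of_letterK : cancel bool_of_letter letter_of_bool.
Proof. by case. Qed.
HB.instance Definition _ := Finite.copy letter (can_type bool_of_letterK).

Definition word := seq letter.

Definition palindrome (p : word) : Prop := rev p = p.

Definition is_pal_closure (u p : word) : Prop :=
  [/\ palindrome p, prefix u p
    & forall q : word, palindrome q -> prefix u q -> size p <= size q].

(* Right palindromic closure; well defined by pal_closureP and
   pal_closure_uniq below. *)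
Definition pal_closure (u : word) : word :=
  epsilon (inhabits [::]) (is_pal_closure u).

Definition psi (v : word) : word :=
  foldl (fun p x => pal_closure (rcons p x)) [::] v.

Definition christoffel_of (v : word) : word := la :: rcons (psi v) lb.

Definition proper_christoffel (w : word) : Prop :=
  exists v : word, w = christoffel_of v.

Definition christoffel (w : word) : Prop :=
  [\/ w = [:: la], w = [:: lb] | proper_christoffel w].

(* The exponent of the first run of the directive word v, i.e. the index of
   psi v and of christoffel_of v. *)
Definition run_index (v : word) : nat :=
  if v is x :: _ then find (predC1 x) v else 0.

(* The morphism of free monoids extending f. *)
Definition morph (f : letter -> word) (u : word) : word := flatten (map f u).

Definition phi (k : nat) : word -> word :=
  morph (fun x => if x is la then rcons (nseq k.+1 la) lb
                  else rcons (nseq k la) lb).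

Definition phih (k : nat) : word -> word :=
  morph (fun x => if x is la then la :: nseq k lb else la :: nseq k.+1 lb).

(* run_index v = 0 exactly when v is empty, so the three branches are:
   index 0; positive index with v in aA*; positive index with v in bA*. *)
Definition is_derivative (w u : word) : Prop :=
  exists2 v : word, w = christoffel_of v &
    match v with
    | [::] => u = [:: la]
    | la :: _ => phi (run_index v) u = w
    | lb :: _ => phih (run_index v) u = w
    end.

(* By is_derivative_uniq below, at most one word qualifies. When none does,
   epsilon returns an arbitrary word about which nothing is provable, so a
   property of derivative w can only be established by exhibiting the
   preimage. *)
Definition derivative (w : word) : word :=
  epsilon (inhabits [::]) (is_derivative w).

Lemma is_pal_closure_ex (u : word) : exists p, is_pal_closure u p.
Proof.
have H n : forall q : word, size q <= n -> palindrome q -> prefix u q ->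
    exists p, is_pal_closure u p.
  elim: n => [|n IHn] q sq pq uq.
    by exists q; split=> // r _ _; move: sq; rewrite leqn0 => /eqP ->.
  case: (classic (exists r : word, [/\ palindrome r, prefix u r
                                     & size r < size q])).
    by case=> r [pr ur sr]; apply: (IHn r) => //; rewrite -ltnS (leq_trans sr).
  move=> nr; exists q; split=> // r pr ur; rewrite leqNgt; apply/negP=> sr.
  by apply: nr; exists r.
apply: (H _ (u ++ rev u) (leqnn _)); last exact: prefix_prefix.
by rewrite /palindrome rev_cat revK.
Qed.

Lemma pal_closureP (u : word) : is_pal_closure u (pal_closure u).
Proof. exact: epsilon_spec (is_pal_closure_ex u). Qed.

Lemma pal_closure_uniq (u p : word) : is_pal_closure u p -> p = pal_closure u.
Proof.
have [pq uq mq] := pal_closureP u; case=> pp up mp.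
have spq : size p = size (pal_closure u).
  by apply/eqP; rewrite eqn_leq mp // mq.
have s2 : size p <= size u + size u.
  rewrite -{2}(size_rev u) -size_cat; apply: mp; last exact: prefix_prefix.
  by rewrite /palindrome rev_cat revK.
move: (pal_closure u) pq uq spq {mq mp} => q pq uq spq.
have nthu r i : prefix u r -> i < size u -> nth la r i = nth la u i.
  by move=> /prefixP[s ->] lt_iu; rewrite nth_cat lt_iu.
apply: (@eq_from_nth _ la) => // i lt_ip.
have [lt_iu|le_ui] := ltnP i (size u); first by rewrite !nthu.
have lt : size p - i.+1 < size u.
  rewrite ltn_subLR // addSn ltnS.
  by apply: leq_trans s2 _; rewrite leq_add2r.
by rewrite -pp -pq !nth_rev -?spq // !nthu.
Qed.

Lemma psi_rcons (v : word) x :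
  psi (rcons v x) = pal_closure (rcons (psi v) x).
Proof. by rewrite /psi foldl_rcons. Qed.

Lemma psi_prefix (v s : word) x : prefix (rcons (psi v) x) (psi (v ++ x :: s)).
Proof.
elim/last_ind: s => [|s y IHs].
  by rewrite cats1 psi_rcons; have [] := pal_closureP (rcons (psi v) x).
rewrite -rcons_cons -rcons_cat psi_rcons.
have [_ h _] := pal_closureP (rcons (psi (v ++ x :: s)) y).
apply: prefix_trans h; apply: prefix_trans IHs _; exact: prefix_rcons.
Qed.

Lemma psi_inj : injective psi.
Proof.
have nthP v s x : nth la (psi (v ++ x :: s)) (size (psi v)) = x
                  /\ size (psi v) < size (psi (v ++ x :: s)).
  have /prefixP[t ->] := psi_prefix v s x.
  by rewrite cat_rcons nth_cat ltnn subnn size_cat /= addnS ltnS leq_addr.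
suff H (s t v : word) : psi (v ++ s) = psi (v ++ t) -> s = t.
  by move=> s t /(H s t [::]).
elim: s t v => [|x s IHs] [|y t] v //.
- by rewrite cats0 => E; have [_] := nthP v t y; rewrite -E ltnn.
- by rewrite cats0 => E; have [_] := nthP v s x; rewrite E ltnn.
move=> E; have [Ex _] := nthP v s x; have [Ey _] := nthP v t y.
have Exy : x = y by rewrite -Ex -Ey E.
by move: E; rewrite -Exy -!cat_rcons => /IHs ->.
Qed.

Lemma christoffel_of_inj : injective christoffel_of.
Proof. by move=> u v [/rcons_inj[/psi_inj]]. Qed.

Lemma phi_inj k : injective (phi k).
Proof.
have nil x s : phi k (x :: s) <> [::].
  by case: x => /(congr1 size) /=; rewrite size_cat size_rcons.
have nseq_cons (x : letter) s : x :: nseq k x ++ s = nseq k x ++ x :: s.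
  by elim: k {nil} => //= m ->.
have E x s : phi k (x :: s)
             = nseq k la ++ (if x is la then [:: la; lb] else [:: lb]) ++ phi k s.
  rewrite /phi /morph /=; move: (flatten _) => t.
  by case: x; rewrite ?rcons_cons /= cat_rcons // nseq_cons.
elim=> [|x s IHs] [|y t] //.
- by move/esym/nil.
- by move/nil.
rewrite !E => /eqP; rewrite eqseq_cat // eqxx /= => /eqP.
by case: x y => [] [] //= []; [move/IHs-> | move/IHs->].
Qed.

Lemma phih_inj k : injective (phih k).
Proof.
have nb s t : phih k s <> lb :: t by case: s => [|[] s].
have E x s : phih k (x :: s)
             = la :: nseq k lb ++ (if x is la then [::] else [:: lb]) ++ phih k s.
  rewrite /phih /morph /=; move: (flatten _) => t; case: x => //=.
  by congr cons; elim: k {nb} => //= m ->.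
elim=> [|x s IHs] [|y t] //; try by rewrite E.
rewrite !E => -[] /eqP; rewrite eqseq_cat // eqxx /= => /eqP.
case: x y => [] [] /=; first by move/IHs->.
- by move/nb.
- by move/esym/nb.
by case=> /IHs->.
Qed.

Lemma is_derivative_uniq (w u u' : word) :
  is_derivative w u -> is_derivative w u' -> u = u'.
Proof.
case=> v -> H [v' /christoffel_of_inj <-]; case: v H => [|[] v].
- by move=> -> ->.
- by move=> <- /phi_inj.
- by move=> <- /phih_inj.
Qed.

(* Main.v *)
(* Two instances of Justin's formula psi (x v) = mu_x (psi v) x drive the proof:
   with G : a -> a, b -> ab and D : a -> ab, b -> b they say that the Christoffel
   word directed by a v (resp. b v) is the image under G (resp. D) of the one
   directed by v. Since phi_k = G^k D and phih_k = D^k G, removing from v its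
   first run and the letter after it gives the directive word of the preimage;
   when v is a single run the preimage is one letter. *)
Require Import Defs.
From mathcomp Require Import all_boot.
From Stdlib Require Import ClassicalEpsilon.

Set Implicit Arguments.
Unset Strict Implicit.
Unset Printing Implicit Defensive.

Lemma morph_cat f u v : morph f (u ++ v) = morph f u ++ morph f v.
Proof. by rewrite /morph map_cat flatten_cat. Qed.

Lemma morph_comp f g h :
  (forall x, morph f (g x) = h x) -> forall u, morph f (morph g u) = morph h u.
Proof.
by move=> fg; elim=> //= x u IHu; rewrite /morph /= -!/(morph _ _) morph_cat fg IHu.
Qed.

(** * Palindromic closure through the longest palindromic suffix *)

Definition longest_pal_suffix (u t : word) : Prop :=
  [/\ palindrome t, suffix t u
    & forall t', palindrome t' -> suffix t' u -> suffix t' t].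

Lemma longest_pal_suffix_ex u : exists t, longest_pal_suffix u t.
Proof.
elim: u => [|x u [t [pt tu mt]]].
  by exists [::]; split.
case: (eqVneq (rev (x :: u)) (x :: u)) => [pxu|npxu].
  by exists (x :: u); split=> //; exact: suffix_refl.
exists t; split=> // [|t' pt' /suffixP[[|y s] E]].
- exact: suffix_trans tu (suffix_suffix [:: x] u).
- by move: pt' npxu; rewrite /palindrome -[t']/([::] ++ t') -E => ->; rewrite eqxx.
- by case: E => _ E; apply: mt => //; rewrite E suffix_suffix.
Qed.

(** A palindrome extending [s ++ t] by some [z] shorter than [s] starts with [rev z]; stripping
    [rev z] and [z] from its ends leaves a palindromic suffix of [s ++ t] longer than [t]. *)
Lemma pal_closure_cat s t :
  longest_pal_suffix (s ++ t) t -> pal_closure (s ++ t) = s ++ t ++ rev s.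
Proof.
case=> pt _ mt; apply/esym/pal_closure_uniq; split.
- by rewrite /palindrome !rev_cat revK pt catA.
- by rewrite catA prefix_prefix.
move=> q pq /prefixP[z Eq].
have [le_z|lt_z] := leqP (size s) (size z).
  by rewrite Eq !size_cat size_rev addnA leq_add2l.
have := congr1 (take (size z)) pq.
rewrite {1}Eq rev_cat take_size_cat ?size_rev // Eq take_cat.
rewrite size_cat ltn_addr // => Ez.
have Es : s ++ t = rev z ++ drop (size z) (s ++ t).
  by rewrite Ez cat_take_drop.
have : palindrome (drop (size z) (s ++ t)).
  move: pq; rewrite Eq Es; move: (drop _ _) => d.
  rewrite /palindrome !rev_cat revK -!catA => /(congr1 (drop (size (rev z)))).
  rewrite size_rev !drop_size_cat ?size_rev // => /(congr1 (take (size d))).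
  by rewrite !take_size_cat ?size_rev.
have sd : suffix (drop (size z) (s ++ t)) (s ++ t) by rewrite {2}Es suffix_suffix.
move=> /mt/(_ sd)/size_suffix => le_sz.
rewrite size_drop size_cat leq_subLR leq_add2r in le_sz.
by move: (leq_trans lt_z le_sz); rewrite ltnn.
Qed.

(** * Palindromes and their closures under the morphisms [mu x] *)

Definition mu (x : letter) : word -> word :=
  morph (fun y => if y == x then [:: x] else [:: x; y]).

Lemma mu_cons x y u : mu x (y :: u) = (if y == x then [:: x] else [:: x; y]) ++ mu x u.
Proof. by []. Qed.

Lemma mu_cat x u v : mu x (u ++ v) = mu x u ++ mu x v.
Proof. exact: morph_cat. Qed.

Lemma rcons_mu_cons x y u :
  rcons (mu x (y :: u)) x = (if y == x then [:: x] else [:: x; y]) ++ rcons (mu x u) x.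
Proof. by rewrite mu_cons rcons_cat. Qed.

Lemma rcons_mu_head x u : exists s, rcons (mu x u) x = x :: s.
Proof.
case: u => [|y u]; first by exists [::].
by rewrite rcons_mu_cons; case: ifP => _; eexists.
Qed.

(** The trailing [x] permits decoding from the left: a non-final [x] encodes itself if another [x]
    follows, and otherwise opens a two-letter block. *)
Lemma rcons_mu_inj x : injective (fun u => rcons (mu x u) x).
Proof.
move=> u v /=; elim: u v => [|y u IHu] [|z v] //; rewrite ?rcons_mu_cons.
- by have [s ->] := rcons_mu_head x v; case: ifP.
- by have [s ->] := rcons_mu_head x u; case: ifP.
have [s Es] := rcons_mu_head x u; have [t Et] := rcons_mu_head x v.
case: eqVneq => [->|nyx]; case: eqVneq => [->|nzx] /=.
- by case=> /IHu ->.
- by rewrite Es => -[Exz _]; rewrite Exz eqxx in nzx.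
- by rewrite Et => -[Exy _]; rewrite Exy eqxx in nyx.
- by case=> -> /IHu ->.
Qed.

(** Reversal turns a block xy into yx, and x(yx) = (xy)x moves the extra [x] across one block at a
    time. *)
Lemma rev_mu x u : x :: rev (mu x u) = rcons (mu x (rev u)) x.
Proof.
elim: u => //= y u IHu.
rewrite mu_cons rev_cat -cat_cons IHu rev_cons -[rcons (rev u) y]cats1 mu_cat.
by rewrite mu_cons cats0; case: eqP => _; rewrite -!cats1 -!catA.
Qed.

Lemma palindrome_rcons_mu x u : palindrome (rcons (mu x u) x) <-> palindrome u.
Proof.
rewrite /palindrome rev_rcons rev_mu.
by split=> [/rcons_mu_inj|->].
Qed.

(** Since [x] occurs only at the start of a block or as the appended last letter, a suffix starting
    with [x] starts at a block boundary. *)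
Lemma suffix_rcons_mu x u t :
  suffix (x :: t) (rcons (mu x u) x) ->
  exists2 v, x :: t = rcons (mu x v) x & suffix v u.
Proof.
elim: u => [|y u IHu] /suffixP[s].
  by case: s => [|z [|? s]] //= [<-]; exists [::].
have suf v : suffix v u -> suffix v (y :: u).
  by move/suffix_trans; apply; exact: (suffix_suffix [:: y] u).
case: s => [|z s] E; first by exists (y :: u); rewrite ?suffix_refl.
move: E; rewrite rcons_mu_cons; case: eqVneq => [_|nyx] /= [_].
  by move=> E; have [|v Ev /suf] := IHu; [rewrite E suffix_suffix | exists v].
case: s => [|z' s] [Ey E]; first by rewrite Ey eqxx in nyx.
by have [|v Ev /suf] := IHu; [rewrite E suffix_suffix | exists v].
Qed.

Lemma longest_pal_suffix_rcons_mu x u t :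
  longest_pal_suffix u t -> longest_pal_suffix (rcons (mu x u) x) (rcons (mu x t) x).
Proof.
case=> pt /suffixP[s Eu] mt; split.
- exact/palindrome_rcons_mu.
- by rewrite Eu mu_cat rcons_cat suffix_suffix.
case=> [|z t'] pt' st'; first exact: suffix0s.
(* A nonempty palindromic suffix ends in [x], hence also begins with [x] and can be decoded. *)
have Ez : z = x.
  case/suffixP: st' => s' /(congr1 (last x)); rewrite last_rcons last_cat.
  rewrite -[X in last _ X]pt' rev_cons last_rcons; exact: esym.
move: pt' st'; rewrite {}Ez => pt' /suffix_rcons_mu[v Ev /suffixP[s' Eu']].
have /suffixP[s'' Et] : suffix v t.
  by apply: mt; [apply/(palindrome_rcons_mu x); rewrite -Ev | rewrite Eu' suffix_suffix].
by rewrite Ev Et mu_cat rcons_cat suffix_suffix.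
Qed.

Lemma pal_closure_rcons_mu x u :
  pal_closure (rcons (mu x u) x) = rcons (mu x (pal_closure u)) x.
Proof.
have [t lps] := longest_pal_suffix_ex u.
have [_ /suffixP[s Eu] _] := lps.
move: lps (longest_pal_suffix_rcons_mu x lps); rewrite Eu mu_cat rcons_cat => lps lps'.
(* [rev_mu] carries the [x] that follows [mu x t] across the reversed [mu x s]. *)
rewrite !pal_closure_cat // !mu_cat !rcons_cat -rev_mu.
by rewrite cat_rcons.
Qed.

(** * Justin's formula for a one-letter prefix *)

Lemma pal_closure_prefix u v :
  prefix u v -> prefix v (pal_closure u) -> pal_closure v = pal_closure u.
Proof.
move=> uv vp; have [pp _ mp] := pal_closureP u.
apply/esym/pal_closure_uniq; split=> // q pq vq.
by apply: mp => //; apply: prefix_trans vq.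
Qed.

Lemma mu_before_neq x y u s t :
  y != x -> mu x u = s ++ y :: t -> exists s', s = rcons s' x.
Proof.
move=> nyx; elim: u s => [|z u IHu] [|c s] //; rewrite mu_cons.
  by case: ifP => _ [Exy]; rewrite Exy eqxx in nyx.
case: ifP => _ [<-]; first by case/IHu=> s' ->; exists (x :: s').
case: s => [|d s] /=; first by exists [::].
by case=> <- /IHu[s' ->]; exists [:: x, z & s'].
Qed.

(* No two letters other than x are adjacent in an image of mu x, so x precedes
   the longest palindromic suffix of that image, hence follows the image in its
   closure. *)
Lemma pal_closure_mu_rcons x y p :
  y != x -> pal_closure (mu x (rcons p y)) = pal_closure (rcons (mu x (rcons p y)) x).
Proof.
move=> nyx; set w := mu x _.
have Ew : w = rcons (rcons (mu x p) x) y.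
  by rewrite /w -cats1 mu_cat mu_cons (negPf nyx) -!cats1 -catA.
apply/esym/pal_closure_prefix; first exact: prefix_rcons.
have [t lps] := longest_pal_suffix_ex w.
have [pt /suffixP[s Es] mt] := lps.
have [t' Et] : exists t', t = y :: t'.
  case: t {lps} pt Es mt => [|z t'] pt Es mt.
    by have := mt [:: y] erefl; rewrite Ew -cats1 suffix_suffix => /(_ isT).
  have := congr1 (last y) Es; rewrite Ew last_rcons last_cat -[X in last _ X]pt.
  by rewrite rev_cons last_rcons => ->; exists t'.
have [|s' Es'] := @mu_before_neq x y (rcons p y) s t' nyx; first by rewrite -Et.
move: lps; rewrite Es => /pal_closure_cat ->.
have -> : rev s = x :: rev s' by rewrite Es' rev_rcons.
by rewrite catA -cat_rcons prefix_prefix.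
Qed.

Lemma psi_cons x v : psi (x :: v) = rcons (mu x (psi v)) x.
Proof.
elim/last_ind: v => [|v y IHv].
  rewrite -[[:: x]]/(rcons [::] x) psi_rcons -[rcons _ x]/(rcons (mu x [::]) x).
  by rewrite pal_closure_rcons_mu -(@pal_closure_uniq [::] [::]).
rewrite -rcons_cons !psi_rcons IHv -pal_closure_rcons_mu.
(* If [y = x], then [y] is its own block and both sides close the same word. Otherwise the final [x]
   of the induction hypothesis forms a block with [y], and [pal_closure_mu_rcons] supplies the
   missing last [x]. *)
have [->|nyx] := eqVneq y x.
  by rewrite -[rcons (psi v) x]cats1 mu_cat mu_cons eqxx cats1.
rewrite -pal_closure_mu_rcons // -[rcons (psi v) y]cats1 mu_cat mu_cons.
by rewrite (negPf nyx) -!cats1 -catA.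
Qed.

(** * Christoffel words as images under [phi] and [phih] *)

Lemma phih0_mu u : phih 0 u = mu la u.
Proof. by congr flatten; apply: eq_map; case. Qed.

(** [mu lb] sends a to ba whereas [phi 0] sends it to ab; the two morphisms are conjugate by
    [lb]. *)
Lemma phi0_mu u : lb :: phi 0 u = rcons (mu lb u) lb.
Proof. by elim: u => // -[] u IHu; rewrite rcons_mu_cons -IHu. Qed.

Lemma christoffel_of_cons_la v : christoffel_of (la :: v) = phih 0 (christoffel_of v).
Proof.
rewrite phih0_mu /christoffel_of psi_cons mu_cons -[rcons (psi v) lb]cats1 mu_cat.
by rewrite -!cats1 -catA.
Qed.

Lemma christoffel_of_cons_lb v : christoffel_of (lb :: v) = phi 0 (christoffel_of v).
Proof.
rewrite /christoffel_of psi_cons -phi0_mu -cats1 -[rcons (psi v) lb]cats1.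
by rewrite /phi -[la :: psi v ++ _]cat1s !morph_cat.
Qed.

Lemma phiS k u : phi k.+1 u = phih 0 (phi k u).
Proof.
have H n : phih 0 (nseq n la) = nseq n la by elim: n => //= n {2}<-.
have nseqC n s : nseq n la ++ la :: s = la :: nseq n la ++ s by elim: n => //= n ->.
apply/esym/morph_comp => -[]; rewrite -cats1 morph_cat -/(phih 0 _) H -cats1 /=.
  by congr cons; exact: nseqC.
exact: nseqC.
Qed.

Lemma phihS k u : phih k.+1 u = phi 0 (phih k u).
Proof.
have H n : phi 0 (nseq n lb) = nseq n lb by elim: n => //= n {2}<-.
have E n : phi 0 (la :: nseq n lb) = [:: la, lb & nseq n lb].
  by congr [:: la, lb & _]; exact: H.
by apply/esym/morph_comp => -[]; rewrite -/(phi 0 _) E.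
Qed.

(** Allowing zero leading [la] lets the induction peel single letters: each [la] raises the exponent
    by one, the first [lb] is absorbed by [phi 0], and the empty word is reached when [v] is a power
    of [la]. *)
Lemma phi_christoffel v :
  exists2 u, christoffel u & phi (find (predC1 la) v) u = christoffel_of v.
Proof.
elim: v => [|[] v [u cu Eu]] /=; first by exists [:: la]; [constructor 1|].
  by exists u; rewrite // phiS Eu christoffel_of_cons_la.
by exists (christoffel_of v); [constructor 3; exists v | rewrite christoffel_of_cons_lb].
Qed.

Lemma phih_christoffel v :
  exists2 u, christoffel u & phih (find (predC1 lb) v) u = christoffel_of v.
Proof.
elim: v => [|[] v [u cu Eu]] /=; first by exists [:: lb]; [constructor 2|].
  by exists (christoffel_of v); [constructor 3; exists v | rewrite christoffel_of_cons_la].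
by exists u; rewrite // phihS Eu christoffel_of_cons_lb.
Qed.

Lemma derivative_eq w u : is_derivative w u -> derivative w = u.
Proof.
move=> du; apply: is_derivative_uniq (du).
exact: epsilon_spec (ex_intro _ u du).
Qed.

Theorem mainTheorem1 (w : word) (hw : proper_christoffel w) :
  christoffel (derivative w).
Proof.
case: hw => v Ew; suff [u cu du] : exists2 u, christoffel u & is_derivative w u.
  by rewrite (derivative_eq du).
case: v Ew => [|[] v] Ew.
- by exists [:: la]; [constructor 1 | exists [::]].
- have [u cu Eu] := phi_christoffel (la :: v).
  by exists u => //; exists (la :: v); rewrite // Ew.
have [u cu Eu] := phih_christoffel (lb :: v).
by exists u => //; exists (lb :: v); rewrite // Ew.
Qed.
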